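(* Let $n>k\ge 1$ be integers and let $T\in\mathscr{T}_{n,k}$ have vertex degree sequence $(d_i:i\in[n])$. Then for every $x=(x_1,\dots,x_n)\in(\mathbb{R}\setminus\{0\})^n$, $$|\tilde{H}_{k-1}(T)|^2\le\frac{\prod_{i\in[n]}(x_i^2)^{m_1-d_i}}{\left(\sum_{i\in[n]}x_i^2\right)^{m_1}}\prod_{\tau\in T}\sum_{i\in\tau}x_i^2 .$$ Consequently $|\tilde{H}_{k-1}(T)|^2$ is at most the infimum of the right-hand side over all such $x$. The paper states this infimum over $x\in\mathbb{R}^n\setminus\{\mathbf 0\}$, where points having some, but not all, coordinates equal to $0$ are understood as limits of points with all coordinates nonzero.
   Context: Let $n>k\ge1$ be integers and $[n]=\{1,\dots,n\}$. For $j\ge0$, $\binom{[n]}{j}$ denotes the set of $j$-element subsets of $[n]$. A $k$-dimensional simplicial complex $T$ on vertex set $[n]$ is called $\mathbb{Q}$-acyclic if all three of the following hold: - it contains every subset of $[n]$ of size at most $k$ as a face (a full $(k-1)$-skeleton); - it has exactly $\binom{n-1}{k}$ faces of dimension $k$; - its $k$th homology group $H_k(T)$ is zero. $\mathscr{T}_{n,k}$ denotes the set of such complexes. Each $T\in\mathscr{T}_{n,k}$ is identified with its set of $k$-dimensional faces, which is a subset of $\binom{[n]}{k+1}$ of size $\binom{n-1}{k}$. Accordingly, $\prod_{\tau\in T}$ ranges over these $k$-faces. $\tilde H_{k-1}(T)$ denotes the reduced $(k-1)$st homology group of $T$ with integer coefficients. For $T\in\mathscr{T}_{n,k}$ it is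 a finite abelian group, and $|\tilde H_{k-1}(T)|$ denotes its order. The degree $d_i=d_i(T)$ of a vertex $i\in[n]$ is the number of $k$-dimensional faces of $T$ containing $i$. Set $m_1=\binom{n-2}{k-1}$, $m_2=\binom{n-2}{k}$ and $m_3=\binom{n-1}{k}$. *)

(* Defs.v *)
From HB Require Import structures.
From mathcomp Require Import all_boot all_order all_algebra.
From mathcomp Require Import reals.
Set Implicit Arguments. Unset Strict Implicit. Unset Printing Implicit Defensive.
Import Order.TTheory GRing.Theory Num.Theory.
Local Open Scope ring_scope.

(* Faces are subsets of the vertex set 'I_n (vertex i+1 of the paper is i).
   A j-face is a set of size j+1; the empty set is the (-1)-face, so that the
   boundary below from 0-chains to (-1)-chains is the augmentation map and the
   homology computed is REDUCED homology. *)

Definition chain (n : nat) := {ffun {set 'I_n} -> int}.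

(* incidence number [s : t], with the orientation given by the natural order
   of the vertices: if s = t + {v} (v notin t) it is (-1)^(#{u in t | u < v}) *)
Definition bd_coef (n : nat) (s t : {set 'I_n}) : int :=
  \sum_(v : 'I_n | (v \notin t) && (s == v |: t))
     (-1) ^+ #|[set u in t | (u < v)%N]|.

Definition boundary (n : nat) (c : chain n) : chain n :=
  [ffun t => \sum_(s : {set 'I_n}) c s * bd_coef s t].

Definition supported_on (n : nat) (P : pred {set 'I_n}) (c : chain n) : Prop :=
  forall s, ~~ P s -> c s = 0.

(* T (a set of (k+1)-subsets = its k-faces) together with the full
   (k-1)-skeleton is Q-acyclic: right number of k-faces and H_k(T) = 0
   (no nonzero integer k-chain on T with zero boundary). *)
Definition Qacyclic (n k : nat) (T : {set {set 'I_n}}) : Prop :=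
  [/\ forall s, s \in T -> #|s| = k.+1,
      #|T| = 'C(n.-1, k)
    & forall c : chain n, supported_on (fun s => s \in T) c -> boundary c = 0 -> c = 0].

(* reduced (k-1)-cycles of the complex (all k-subsets are (k-1)-faces) *)
Definition kcycle (n k : nat) (z : chain n) : Prop :=
  supported_on (fun s : {set 'I_n} => #|s| == k) z /\ boundary z = 0.

Definition homologous (n : nat) (T : {set {set 'I_n}}) (z1 z2 : chain n) : Prop :=
  exists c : chain n, supported_on (fun s => s \in T) c /\
    forall t, z1 t - z2 t = boundary c t.

(* |H~_{k-1}(T)| = h : the quotient (k-1)-cycles / boundaries has exactly h
   elements, witnessed by a complete list of pairwise non-homologous
   representatives of length h. *)
Definition hom_order (n k : nat) (T : {set {set 'I_n}}) (h : nat) : Prop :=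
  exists zs : seq (chain n),
    [/\ size zs = h,
        forall z, z \in zs -> kcycle k z,
        forall i j, (i < h)%N -> (j < h)%N -> i != j ->
          ~ homologous T (nth 0 zs i) (nth 0 zs j)
      & forall z, kcycle k z -> exists2 y, y \in zs & homologous T z y].

Definition degree (n : nat) (T : {set {set 'I_n}}) (i : 'I_n) : nat :=
  #|[set s in T | i \in s]|.

(* Main.v *)
(* Let A be the integer matrix of the k-th boundary map with columns the faces of T
   and rows the k-subsets avoiding vertex 0. A (k-1)-cycle is determined by its
   coefficients on those k-subsets, which can be arbitrary (cone from vertex 0), so
   H~_{k-1}(T) is the cokernel of A and its order is |det A|.
   Let now M be the boundary matrix with columns in T, all k-subsets as rows, and
   the entry of v |: t at t weighted by x_v. Its columns have squared norms
   sum_(i in tau) x_i^2, so Hadamard's inequality bounds det (M^T M) by their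
   product. Since the boundary squares to 0, each row through vertex 0 is a
   combination, independent of T, of the rows avoiding vertex 0; hence
   det (M^T M) = det(B)^2 det(1 + L / x_0^2), where B is the weighted version of A
   and L is the Gram matrix of the weighted boundary of the simplex on the other
   vertices. Up to the factor sum_(i != 0) x_i^2, L is a projection of rank
   'C(n-2, k-1), which gives its contribution ((sum_i x_i^2) / x_0^2)^'C(n-2, k-1). *)
Require Import Defs.
From HB Require Import structures.
From mathcomp Require Import all_boot all_order all_algebra.
From mathcomp Require Import reals ring zify.
Import Order.TTheory GRing.Theory Num.Theory.
Local Open Scope ring_scope.
Set Implicit Arguments. Unset Strict Implicit. Unset Printing Implicit Defensive.

(** * Determinants *)

(** Sylvester's identity: the block matrix with rows [1, - C] and [D, 1] has two triangular
    factorizations, whose determinants are compared. *)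
Lemma det_1addmxC (R : comNzRingType) (m r : nat) (C : 'M[R]_(m, r)) (D : 'M[R]_(r, m)) :
  \det (1%:M + C *m D) = \det (1%:M + D *m C).
Proof.
have E1 : block_mx 1%:M (- C) D 1%:M =
  block_mx 1%:M 0 D 1%:M *m block_mx 1%:M (- C) 0 (1%:M + D *m C).
  rewrite mulmx_block !mul1mx !mulmx1 !mul0mx ?mulmx0 !addr0 mulmxN.
  by rewrite addrCA addNr addr0.
have E2 : block_mx 1%:M (- C) D 1%:M =
  block_mx 1%:M (- C) 0 1%:M *m block_mx (1%:M + C *m D) 0 D 1%:M.
  rewrite mulmx_block !mul1mx !mulmx1 !mul0mx ?mulmx0 !add0r mulNmx.
  by rewrite addrK.
have := congr1 determinant E1; rewrite E2 !det_mulmx !det_ublock !det_lblock.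
by rewrite !det1 !mulr1 !mul1r.
Qed.

(** In a rank factorization E = C D, idempotence forces D C = 1, so [det_1addmxC] leaves a scalar
    matrix of size rank E. In characteristic 0 the trace shows that this rank is [r]. *)
Lemma det_1add_idempotent (F : numFieldType) (m r : nat) (E : 'M[F]_m) (a : F) :
  E *m E = E -> \tr E = r%:R -> \det (1%:M + a *: E) = (1 + a) ^+ r.
Proof.
move=> EE trE; set C := col_base E; set D := row_base E.
have CD : C *m D = E by apply: mulmx_base.
have [C' C'C] : exists C', C' *m C = 1%:M by apply/row_fullP; apply: col_base_full.
have Dfree : row_free D by apply: row_base_free.
clearbody C D.
have DC : D *m C = 1%:M.
  apply: (row_free_inj Dfree); rewrite mul1mx.
  rewrite -[LHS]mul1mx -[RHS]mul1mx -C'C -!mulmxA; congr (_ *m _).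
  by rewrite mulmxA CD EE.
have rk : \rank E = r.
  by apply/eqP; rewrite -(eqr_nat F) -trE -[X in \tr X]CD mxtrace_mulC DC mxtrace1.
rewrite -[X in a *: X]CD scalemxAl det_1addmxC -scalemxAr DC.
by rewrite scalemx1 -raddfD det_scalar rk.
Qed.

Lemma mulmx_tr_ge0 (F : realFieldType) (p : nat) (v : 'rV[F]_p) : 0 <= (v *m v^T) 0 0.
Proof. by rewrite mxE sumr_ge0 // => i _; rewrite mxE -expr2 sqr_ge0. Qed.

Lemma mulmx_tr_eq0 (F : realFieldType) (p : nat) (v : 'rV[F]_p) :
  v *m v^T = 0 -> v = 0.
Proof.
move=> /matrixP /(_ 0 0); rewrite !mxE => /eqP.
rewrite psumr_eq0 => [|i _]; last by rewrite mxE -expr2 sqr_ge0.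
move=> /allP v0; apply/rowP => i; rewrite mxE; apply/eqP.
by have := v0 i (mem_index_enum _); rewrite mxE mulf_eq0 orbb.
Qed.

(* Induction on the rows: the Schur complement of the Gram matrix of the other
   rows is the squared distance from the first row to their span. *)
Lemma hadamard_gram (F : realFieldType) (p m : nat) (A : 'M[F]_(m, p)) :
  0 <= \det (A *m A^T) <= \prod_i (A *m A^T) i i.
Proof.
elim: m => [|m IHm] in A *.
  by rewrite det_mx00 big_ord0 ler01 lexx.
rewrite -[m.+1]/(1 + m)%N in A *.
rewrite -[A]vsubmxK; move: (usubmx A) (dsubmx A) => a B {A}.
have G0 i : 0 <= (B *m B^T) i i.
  by rewrite mxE sumr_ge0 // => j _; rewrite mxE -expr2 sqr_ge0.
have E : col_mx a B *m (col_mx a B)^T =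
    block_mx (a *m a^T) (a *m B^T) (B *m a^T) (B *m B^T).
  by rewrite tr_col_mx mul_col_row.
have [/andP[H1 H2]] := (IHm B).
have PE : \prod_i (col_mx a B *m (col_mx a B)^T) i i =
    (a *m a^T) 0 0 * \prod_i (B *m B^T) i i.
  rewrite E big_split_ord /= big_ord_recl big_ord0 mulr1.
  rewrite (_ : lshift m ord0 = lshift m 0) // block_mxEul.
  by congr (_ * _); apply: eq_bigr => i _; rewrite block_mxEdr.
(* If the smaller Gram matrix kills [v], the squared norm of v B vanishes, so v B = 0; padded with
   0, [v] also kills the larger matrix. *)
have [/eqP d0|d0] := eqVneq (\det (B *m B^T)) 0.
  suff /eqP -> : \det (col_mx a B *m (col_mx a B)^T) == 0.
    by rewrite lexx PE mulr_ge0 ?mulmx_tr_ge0 // prodr_ge0.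
  have /det0P [v v0 vB] := d0.
  have {}vB : v *m B = 0.
    by apply: mulmx_tr_eq0; rewrite trmx_mul -mulmxA (mulmxA B) mulmxA vB mul0mx.
  apply/det0P; exists (row_mx 0 v).
    by apply: contraNneq v0 => /(congr1 rsubmx); rewrite row_mxKr raddf0 => ->.
  by rewrite mulmxA mul_row_col mul0mx vB addr0 mul0mx.
have U : B *m B^T \in unitmx by rewrite unitmxE unitfE.
(* [w *m B] is the orthogonal projection of [a] to the row span of [B], and [s] is the squared norm
   of the remainder. *)
set w := a *m B^T *m invmx (B *m B^T).
have wG : w *m (B *m B^T) = a *m B^T by rewrite mulmxKV.
pose s := (a - w *m B) *m (a - w *m B)^T.
have sB : (a - w *m B) *m B^T = 0 by rewrite mulmxBl -mulmxA wG subrr.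
have sE : s = a *m a^T - w *m (B *m a^T).
  by rewrite /s raddfB /= trmx_mul mulmxBr (mulmxA _ B^T) sB mul0mx subr0 mulmxBl mulmxA.
(* Pythagoras, which bounds [s] by the squared norm of [a]. *)
have sE' : s = a *m a^T - (w *m B) *m (w *m B)^T.
  rewrite sE mulmxA; congr (_ - _).
  have : (w *m B) *m (a - w *m B)^T = 0.
    by apply: trmx_inj; rewrite trmx_mul trmxK trmx_mul mulmxA sB mul0mx trmx0.
  by rewrite raddfB mulmxBr => /eqP; rewrite subr_eq0 => /eqP.
have -> : \det (col_mx a B *m (col_mx a B)^T) = s 0 0 * \det (B *m B^T).
  have -> : col_mx a B *m (col_mx a B)^T =
     block_mx 1%:M w 0 1%:M *m block_mx s 0 (B *m a^T) (B *m B^T).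
    rewrite mulmx_block !mul1mx !mul0mx !add0r E wG.
    by rewrite sE subrK.
  by rewrite det_mulmx det_ublock det_lblock !det1 !mul1r det_mx11.
rewrite mulr_ge0 ?mulmx_tr_ge0 //= PE.
apply: ler_pM => //; first exact: mulmx_tr_ge0.
by rewrite sE' 3!mxE lerBlDr lerDl mulmx_tr_ge0.
Qed.

(** * Cokernels of integer matrices *)

Lemma absz_det_unimodular (m : nat) (A : 'M[int]_m) : A \in unitmx -> `|\det A|%N = 1%N.
Proof. by rewrite unitmxE => /orP[] /eqP->. Qed.

(** By the Smith normal form L D Q, being in the image means that the coordinates of [invmx L *m v]
    are divisible by the diagonal entries. A box of remainders thus represents every coset once, and
    the unimodular factors do not affect the absolute value of the determinant. *)
Lemma int_cokernel_order (m : nat) (A : 'M[int]_m) : \det A != 0 ->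
  exists vs : seq 'cV[int]_m,
  [/\ size vs = `|\det A|%N,
      forall i j, (i < `|\det A|)%N -> (j < `|\det A|)%N -> i != j ->
        ~ exists c, vs`_i - vs`_j = A *m c
    & forall v, exists2 w, w \in vs & exists c, v - w = A *m c].
Proof.
have [L Lu [Q Qu [d _ ->]]] := int_Smith_normal_form A.
set D := (\matrix_(i, j) _); pose e (i : 'I_m) := absz (nth 0 d i).
have De (c : 'cV[int]_m) i : (D *m c) i ord0 = d`_i * c i ord0.
  rewrite mxE (bigD1 i) //= mxE eqxx mulr1n big1 ?addr0 // => j ji.
  by rewrite mxE eq_sym val_eqE (negPf ji) mulr0n mul0r.
have detD : \det D = \prod_(i < m) d`_i.
  have -> : D = diag_mx (\row_i d`_i).
    by apply/matrixP => i j; rewrite !mxE val_eqE; case: eqP => [->|].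
  by rewrite det_diag; apply: eq_bigr => i _; rewrite mxE.
rewrite !det_mulmx !mulf_eq0 !negb_or => /andP[/andP[_ Dn0] _].
have e_gt0 i : (0 < e i)%N.
  by rewrite absz_gt0; move: Dn0; rewrite detD => /prodf_neq0 ->.
have -> : absz (\det L * \det D * \det Q) = (\prod_i e i)%N.
  rewrite !abszM (absz_det_unimodular Lu) (absz_det_unimodular Qu) mul1n muln1 detD.
  by elim/big_ind2: _ => // x1 x2 y1 y2 <- <-; rewrite abszM.
(* The remainders range over different intervals; the bound [b] places them in one finite type, and
   [F] restores the individual ranges. *)
pose b := (\max_i e i)%N.
pose F (i : 'I_m) := [pred j : 'I_b.+1 | (j < e i)%N].
pose rep (f : {ffun 'I_m -> 'I_b.+1}) : 'cV[int]_m := L *m (\col_i (f i)%:Z).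
have eqv (v w : 'cV[int]_m) : (exists c, v - w = L *m D *m Q *m c) <->
    forall i, (d`_i %| (invmx L *m v - invmx L *m w) i ord0)%Z.
  rewrite -mulmxBr; split => [[c ->] i|dv].
    by rewrite -!mulmxA mulKmx // De dvdz_mulr.
  have vwE : v - w = L *m (invmx L *m (v - w)) by rewrite mulKVmx.
  rewrite {}vwE; move: (invmx L *m (v - w)) dv => u dv.
  exists (invmx Q *m \col_i (u i ord0 %/ d`_i)%Z).
  rewrite -!mulmxA mulKVmx //; congr (_ *m _).
  by apply/colP => i; rewrite De mxE mulrC divzK.
have repK f i : (invmx L *m rep f) i ord0 = (f i)%:Z by rewrite mulKmx // mxE.
have rep_inj f g : f \in family F -> g \in family F ->
    (exists c, rep f - rep g = L *m D *m Q *m c) -> f = g.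
  move=> /familyP fF /familyP gF /eqv dv; apply/ffunP => i; apply/val_inj => /=.
  have := dv i; rewrite mxE [in X in _ + X]mxE !repK -eqz_mod_dvd.
  have fi : (f i < e i)%N by have := fF i.
  have gi : (g i < e i)%N by have := gF i.
  by rewrite -(modz_abs _ d`_i) -(modz_abs (g i) d`_i) !modz_small // => /eqP[].
have card_F : #|family F| = (\prod_i e i)%N.
  rewrite card_family foldrE big_map big_enum /=; apply: eq_bigr => i _.
  have ei : (e i <= b.+1)%N by apply: leqW; apply: leq_bigmax.
  have wI : injective (widen_ord ei) by move=> x y /(congr1 val) /= /val_inj.
  rewrite -[RHS]card_ord -(card_imset _ wI); apply: eq_card => j.
  apply/idP/imsetP => [ji|[k _ ->]]; last exact: (ltn_ord k).
  by exists (Ordinal ji) => //; apply/val_inj.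
exists [seq rep f | f <- enum (family F)]; split.
- by rewrite size_map -cardE.
- move=> i j; rewrite -card_F cardE => ilt jlt ij.
  have f0 : {ffun 'I_m -> 'I_b.+1} := [ffun=> ord0].
  rewrite !(nth_map f0) // => /rep_inj => E; move/negP: ij; apply.
  rewrite -(nth_uniq f0 ilt jlt (enum_uniq _)); apply/eqP/E.
    by rewrite -mem_enum mem_nth.
  by rewrite -mem_enum mem_nth.
- move=> v; pose r (i : 'I_m) := ((invmx L *m v) i ord0 %% d`_i)%Z.
  have d0 (i : 'I_m) : d`_i != 0 by rewrite -absz_gt0; exact: e_gt0.
  have rE i : (`|r i|%N : int) = r i by rewrite gez0_abs // modz_ge0.
  have rlt i : (`|r i| < e i)%N by rewrite -ltz_nat rE /e abszE ltz_mod.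
  exists (rep [ffun i => inord `|r i|%N]).
    apply: map_f; rewrite mem_enum; apply/familyP => i; rewrite ffunE inE inordK //.
    by rewrite ltnS (leq_trans (ltnW (rlt i))) // leq_bigmax.
  apply/eqv => i; rewrite mxE [in X in _ + X]mxE repK ffunE inordK.
    by rewrite rE -eqz_mod_dvd modz_mod.
  by rewrite ltnS (leq_trans (ltnW (rlt i))) // leq_bigmax.
Qed.

(** * The weighted boundary operator *)

Section WeightedBoundary.
Variables (n : nat) (R : numDomainType).
Implicit Types (x : 'I_n -> R) (s t r : {set 'I_n}) (v w : 'I_n).

(** As a product over [s], it changes by one factor when a vertex is added or removed. If [v] is in
    [s], its own factor is 1. *)
Definition vsign s v : R := \prod_(u in s) (-1) ^+ (u < v)%N.

Definition wbd x s t : R :=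
  \sum_(v | (v \notin t) && (s == v |: t)) x v * vsign t v.

Definition flip v s := if v \in s then s :\ v else v |: s.

(* Matrix of the Clifford multiplication by x on the exterior algebra. The graded
   pieces of [clif_sqr] are the identity d d = 0 and the Laplacian identity. *)
Definition clif x s t : R := \sum_(v | t == flip v s) x v * vsign s v.

Lemma vsignE s v : vsign s v = (-1) ^+ #|[set u in s | (u < v)%N]|.
Proof.
rewrite /vsign prodrXr -sum1_card; congr (_ ^+ _).
rewrite big_mkcond [RHS]big_mkcond; apply: eq_bigr => u _; rewrite inE.
by case: (u \in s) => //=; case: (u < v)%N.
Qed.

Lemma vsign_sqr s v : vsign s v * vsign s v = 1.
Proof. by rewrite vsignE -expr2 sqrr_sign. Qed.

Lemma flipK v : involutive (flip v).
Proof.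
move=> s; rewrite /flip; case vs: (v \in s).
  by rewrite !inE eqxx setD1K.
by rewrite setU11 setU1K // vs.
Qed.

Lemma in_flip v s u : (u \in flip v s) = (u \in s) (+) (u == v).
Proof.
rewrite /flip; case: ifP => vs; rewrite !inE; case: eqP => [->|_] /=;
  by rewrite ?vs ?addbF.
Qed.

Lemma flipC v w s : flip v (flip w s) = flip w (flip v s).
Proof. by apply/setP => u; rewrite !in_flip -!addbA (addbC (u == v)). Qed.

Lemma flip_eq v s t : (t == flip v s) = (s == flip v t).
Proof. by apply/eqP/eqP => ->; rewrite flipK. Qed.

Lemma vsign_flip v w s : vsign (flip v s) w = (-1) ^+ (v < w)%N * vsign s w.
Proof.
rewrite /vsign /flip; case: ifPn => vs; last by rewrite big_setU1.
by rewrite [in RHS](big_setD1 v vs) mulrA -expr2 sqrr_sign mul1r.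
Qed.

(* The operators attached to two distinct vertices anticommute. *)
Lemma clif_sqr x s r :
  \sum_t clif x s t * clif x t r = (\sum_v x v ^+ 2) *+ (s == r).
Proof.
pose F v w := (x v * vsign s v * (x w * vsign (flip v s) w)) *+ (r == flip w (flip v s)).
have -> : \sum_t clif x s t * clif x t r = \sum_v \sum_w F v w.
  under eq_bigr do rewrite /clif mulr_suml.
  rewrite (exchange_big_dep predT) //=; apply: eq_bigr => v _.
  rewrite big_pred1_eq mulr_sumr [LHS]big_mkcond; apply: eq_bigr => w _.
  by rewrite /F; case: eqP.
have FC v w : F v w + F w v = (x v ^+ 2) *+ (s == r) *+ (v == w) *+ 2.
  rewrite /F (flipC v w) !vsign_flip; have [<-|vw] := eqVneq v w.
    rewrite flipK (eq_sym r) ltnn mul1r mulrACA vsign_sqr mulr1 -expr2.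
    by rewrite mulr1n -mulr2n.
  rewrite mulr0n mul0rn -mulrnDl [X in X *+ _](_ : _ = 0) ?mul0rn //.
  have -> : (-1) ^+ (w < v)%N = - (-1) ^+ (v < w)%N :> R.
    by case: (ltngtP v w) vw => [||/val_inj->]; rewrite ?eqxx // expr1 expr0 ?opprK.
  by ring.
(* Doubling allows symmetrization in [v] and [w], so that only the diagonal survives; the factor 2
   cancels afterwards. *)
suff : (\sum_v \sum_w F v w) *+ 2 = (\sum_v x v ^+ 2) *+ (s == r) *+ 2.
  by move/eqP; rewrite -subr_eq0 -mulrnBl mulrn_eq0 /= subr_eq0 => /eqP.
rewrite mulr2n [X in _ + X]exchange_big -big_split /= -!sumrMnl; apply: eq_bigr => v _.
rewrite -big_split /= (bigD1 v) //= FC eqxx big1 ?addr0 // => w wv.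
by rewrite FC (eq_sym v) (negPf wv) mulr0n mul0rn.
Qed.

(** A flip either removes [v] from [s], which is the boundary, or adds it, which is the
    transpose. *)
Lemma clif_wbd x s t : clif x s t = wbd x s t + wbd x t s.
Proof.
rewrite /clif /wbd (bigID (fun v => v \in t)) /= addrC; congr (_ + _).
- have E v : ((t == flip v s) && (v \notin t)) = ((v \notin t) && (s == v |: t)).
    by rewrite andbC flip_eq /flip; case: (v \in t).
  rewrite (eq_bigl _ _ E); apply: eq_bigr => v /andP[vt /eqP->].
  have -> : v |: t = flip v t by rewrite /flip (negPf vt).
  by rewrite vsign_flip ltnn mul1r.
- apply: eq_bigl => v; apply/andP/andP => [[/eqP-> ]|[vs /eqP->]].
    by rewrite in_flip eqxx addbT => vs; rewrite /flip (negPf vs).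
  by rewrite /flip (negPf vs) setU11.
Qed.

Lemma wbd_neq0 x s t : wbd x s t != 0 -> exists v, [/\ v \notin t, s = v |: t & x v != 0].
Proof.
move=> b0; case: (pickP (fun v => [&& v \notin t, s == v |: t & x v != 0])).
  by move=> v /and3P[vt /eqP st xv]; exists v.
move=> no; case/eqP: b0; apply: big1 => v /andP[vt st].
by have := no v; rewrite vt st /= => /negbFE/eqP->; rewrite mul0r.
Qed.

Lemma wbd_card x s t : wbd x s t != 0 -> #|s| = #|t|.+1.
Proof. by case/wbd_neq0 => v [vt -> _]; rewrite cardsU1 vt. Qed.

Lemma wbd_mul_eq0 x s t s' t' :
  ~~ ((#|s| == #|t|.+1) && (#|s'| == #|t'|.+1)) -> wbd x s t * wbd x s' t' = 0.
Proof.
apply: contraNeq; rewrite mulf_eq0 negb_or => /andP[].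
by move=> /wbd_card-> /wbd_card->; rewrite !eqxx.
Qed.

(** For sizes differing by two, only the product of two boundaries survives in [clif_sqr], and its
    right-hand side is off the diagonal. *)
Lemma wbd_sqr x s r : \sum_t wbd x s t * wbd x t r = 0.
Proof.
have [sr|sr] := eqVneq #|s| #|r|.+2; last first.
  by apply: big1 => t _; rewrite wbd_mul_eq0 //; lia.
transitivity (\sum_t clif x s t * clif x t r).
  apply: eq_bigr => t _; rewrite !clif_wbd mulrDl !mulrDr.
  rewrite [X in _ + X + _]wbd_mul_eq0; last lia.
  rewrite [X in _ + (X + _)]wbd_mul_eq0; last lia.
  by rewrite [X in _ + (_ + X)]wbd_mul_eq0 ?addr0 //; lia.
rewrite clif_sqr (_ : s == r = false) ?mulr0n //.
by apply: contra_eqF sr => /eqP->; lia.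
Qed.

(** For equal sizes, only the two mixed products of a boundary and a transpose survive in
    [clif_sqr]. *)
Lemma wbd_laplace x s r :
  \sum_t wbd x t s * wbd x t r + \sum_t wbd x s t * wbd x r t =
  (\sum_v x v ^+ 2) *+ (s == r).
Proof.
have [sr|sr] := eqVneq #|s| #|r|; last first.
  rewrite big1 ?add0r => [|t _]; last by rewrite wbd_mul_eq0 //; lia.
  rewrite big1 => [|t _]; last by rewrite wbd_mul_eq0 //; lia.
  by rewrite (_ : s == r = false) ?mulr0n //; apply: contra_neqF sr => /eqP->.
rewrite -clif_sqr -big_split; apply: eq_bigr => t _ /=.
rewrite !clif_wbd mulrDl !mulrDr.
rewrite [X in _ = X + _ + _]wbd_mul_eq0; last lia.
rewrite [X in _ = _ + (_ + X)]wbd_mul_eq0; last lia.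
by ring.
Qed.

Lemma wbd_setU1 x t v : v \notin t -> wbd x (v |: t) t = x v * vsign t v.
Proof.
move=> vt; rewrite /wbd (big_pred1 v) // => w /=.
apply/andP/eqP => [[wt /eqP/setP/(_ w)]|->]; last by rewrite vt eqxx.
by rewrite setU11 !inE (negPf wt) orbF => /eqP.
Qed.

Lemma wbd_norm x s : \sum_t wbd x s t * wbd x s t = \sum_(v in s) x v ^+ 2.
Proof.
under eq_bigr do rewrite {1}/wbd mulr_suml.
rewrite (exchange_big_dep (mem s)) /= => [|t v _ /andP[_ /eqP->]]; last exact: setU11.
apply: eq_bigr => v vs.
rewrite (big_pred1 (s :\ v)) => [|t /=]; last first.
  apply/andP/eqP => [[vt /eqP->]|->]; first by rewrite setU1K.
  by rewrite !inE eqxx setD1K.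
have vs' : v \notin s :\ v by rewrite !inE eqxx.
rewrite -{2}(setD1K vs) wbd_setU1 //.
by rewrite mulrACA vsign_sqr mulr1 expr2.
Qed.

Lemma eq_wbd x y s t : {in s, x =1 y} -> wbd x s t = wbd y s t.
Proof.
move=> xy; apply: eq_bigr => v /andP[_ /eqP sE].
by rewrite xy // sE setU11.
Qed.

(** The weights amount to a diagonal rescaling of rows and columns of the unweighted boundary
    matrix. *)
Lemma wbd_scale x s t :
  wbd x s t * \prod_(v in t) x v = wbd (fun=> 1) s t * \prod_(v in s) x v.
Proof.
rewrite !mulr_suml; apply: eq_bigr => v /andP[vt /eqP->].
by rewrite big_setU1 //=; ring.
Qed.

Definition wlap x s r := \sum_t wbd x s t * wbd x r t.

(** With M the matrix of [wbd x] and q the sum of squares, [wlap] is M M^T and [wbd_laplace] reads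
    M^T M = q - M M^T. Substituting this in M (M^T M) M^T leaves q M M^T, since M M = 0. *)
Lemma wlap_sqr x s r :
  \sum_t wlap x s t * wlap x t r = (\sum_v x v ^+ 2) * wlap x s r.
Proof.
transitivity (\sum_a wbd x s a * \sum_b (\sum_t wbd x t a * wbd x t b) * wbd x r b).
  under eq_bigr do rewrite /wlap mulr_suml.
  rewrite exchange_big; apply: eq_bigr => a _ /=.
  under [in RHS]eq_bigr do rewrite mulr_suml.
  rewrite exchange_big mulr_sumr; apply: eq_bigr => t _.
  by rewrite -mulrA mulr_sumr; congr (_ * _); apply: eq_bigr => b _; rewrite mulrA.
have gramE a b : \sum_t wbd x t a * wbd x t b =
    (\sum_v x v ^+ 2) *+ (a == b) - \sum_c wbd x a c * wbd x b c.
  by rewrite -wbd_laplace addrK.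
have E a : \sum_b (\sum_t wbd x t a * wbd x t b) * wbd x r b =
    (\sum_v x v ^+ 2) * wbd x r a - \sum_c wbd x a c * \sum_b wbd x b c * wbd x r b.
  under eq_bigr do rewrite gramE mulrBl.
  rewrite sumrB (bigD1 a) //= eqxx mulr1n [X in _ + X - _]big1 ?addr0 => [|b ba]; last first.
    by rewrite eq_sym (negPf ba) mulr0n mul0r.
  congr (_ - _); under eq_bigr do rewrite mulr_suml.
  rewrite exchange_big; apply: eq_bigr => c _ /=; rewrite mulr_sumr.
  by apply: eq_bigr => b _; rewrite mulrA.
under eq_bigr do rewrite E mulrBr.
rewrite sumrB [X in _ - X](_ : _ = 0) ?subr0.
  by rewrite mulr_sumr; apply: eq_bigr => a _; ring.
under eq_bigr do rewrite mulr_sumr.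
rewrite exchange_big big1 // => c _ /=.
under eq_bigr do rewrite mulrA.
by rewrite -mulr_suml wbd_sqr mul0r.
Qed.

End WeightedBoundary.

(** * Homology of acyclic complexes *)

Lemma bd_coefE n (s t : {set 'I_n}) : bd_coef s t = wbd (fun=> 1 : int) s t.
Proof. by apply: eq_bigr => v _; rewrite mul1r vsignE. Qed.

Lemma vsign_ord0 n (R : numDomainType) (s : {set 'I_n.+1}) : vsign R s ord0 = 1.
Proof. by rewrite /vsign big1. Qed.

Lemma big_setU1_ord0 n (V : nmodType) (F : {set 'I_n.+1} -> V) :
  \sum_(s : {set 'I_n.+1} | ord0 \in s) F s =
  \sum_(t : {set 'I_n.+1} | ord0 \notin t) F (ord0 |: t).
Proof.
rewrite (reindex_onto (fun t : {set 'I_n.+1} => ord0 |: t)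
  (fun s : {set 'I_n.+1} => s :\ ord0)) => [|s]; last exact: setD1K.
apply: eq_bigl => t; rewrite setU11 /=; apply/eqP/idP => [<-|/setU1K//].
by rewrite !inE eqxx.
Qed.

(** Among the sets through vertex 0, only [ord0 |: t] has [t] in its boundary, so the cycle
    condition at [t] can be solved for its coefficient. This serves integer cycles as well as
    boundaries of weighted faces. *)
Lemma wbd_cycle_ord0 n (R : numDomainType) (x : 'I_n.+1 -> R) (z : {set 'I_n.+1} -> R)
    (t : {set 'I_n.+1}) :
  ord0 \notin t -> \sum_s z s * wbd x s t = 0 ->
  z (ord0 |: t) * x ord0 = - \sum_(s : {set 'I_n.+1} | ord0 \notin s) z s * wbd x s t.
Proof.
move=> t0; rewrite (bigID (fun s : {set 'I_n.+1} => ord0 \in s)) /= big_setU1_ord0 => /eqP.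
rewrite addr_eq0 (bigD1 t) //= big1 ?addr0 => [|r /andP[r0 rt]].
  by rewrite wbd_setU1 // vsign_ord0 mulr1 => /eqP.
rewrite [X in _ * X](_ : _ = 0) ?mulr0 //; apply: contraNeq rt => /wbd_neq0[v [vt rE _]].
have : ord0 \in v |: t by rewrite -rE setU11.
rewrite !inE (negPf t0) orbF => /eqP v0; rewrite -v0 in rE.
by rewrite -(setU1K r0) rE setU1K.
Qed.

Section Chains.
Variable n : nat.
Implicit Types z : chain n.+1.

Lemma boundaryE (c : chain n.+1) t : boundary c t = \sum_s c s * wbd (fun=> 1) s t.
Proof. by rewrite ffunE; apply: eq_bigr => s _; rewrite bd_coefE. Qed.

Lemma boundaryK (c : chain n.+1) : boundary (boundary c) = 0.
Proof.
apply/ffunP => r; rewrite boundaryE ffunE.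
under eq_bigr do rewrite boundaryE mulr_suml.
rewrite exchange_big big1 // => s _ /=; under eq_bigr do rewrite -mulrA.
by rewrite -mulr_sumr wbd_sqr mulr0.
Qed.

Lemma boundaryB (c : chain n.+1) z : boundary (c - z) = boundary c - boundary z.
Proof.
apply/ffunP => t; rewrite !ffunE -sumrB; apply: eq_bigr => s _.
by rewrite !ffunE mulrBl.
Qed.

Lemma supported_onB (P : pred {set 'I_n.+1}) (c z : chain n.+1) :
  supported_on P c -> supported_on P z -> supported_on P (c - z).
Proof. by move=> Pc Pz s Ps; rewrite !ffunE Pc // Pz // subrr. Qed.

Lemma supported_boundary k (c : chain n.+1) :
  supported_on (fun s => #|s| == k.+1) c -> supported_on (fun s => #|s| == k) (boundary c).
Proof.
move=> cS t tk; rewrite boundaryE big1 // => s _.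
have [sk|sk] := boolP (#|s| == k.+1); last by rewrite cS // mul0r.
rewrite [X in _ * X](_ : _ = 0) ?mulr0 //.
by apply: contraNeq tk => /wbd_card; lia.
Qed.

Lemma kcycleB k z1 z2 : kcycle k z1 -> kcycle k z2 -> kcycle k (z1 - z2).
Proof.
move=> [S1 b1] [S2 b2]; split; first exact: supported_onB.
by rewrite boundaryB b1 b2 subrr.
Qed.

Lemma kcycle_eq0 k z : kcycle k z ->
  (forall s : {set 'I_n.+1}, ord0 \notin s -> #|s| = k -> z s = 0) -> z = 0.
Proof.
move=> [zS bz] z0.
have {}z0 (s : {set 'I_n.+1}) : ord0 \notin s -> z s = 0.
  by have [/eqP|/zS//] := boolP (#|s| == k) => sk s0; apply: z0.
apply/ffunP => s; rewrite ffunE; have [s0|/z0//] := boolP (ord0 \in s).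
have t0 : ord0 \notin s :\ ord0 by rewrite !inE eqxx.
have := wbd_cycle_ord0 (x := fun=> 1) (z := z) t0; rewrite setD1K // mulr1 => ->.
  by rewrite big1 ?oppr0 // => r /z0->; rewrite mul0r.
by rewrite -boundaryE bz ffunE.
Qed.

Variables (k m : nat) (T : {set {set 'I_n.+1}}) (u tau : 'I_m -> {set 'I_n.+1}).
Hypotheses (u_inj : injective u) (tau_inj : injective tau).
Hypothesis uE : [set u a | a : 'I_m] = [set s : {set 'I_n.+1} | (ord0 \notin s) && (#|s| == k)].
Hypothesis tauE : [set tau j | j : 'I_m] = T.
Hypothesis cardT : forall s, s \in T -> #|s| = k.+1.

Definition link_mx : 'M[int]_m := \matrix_(a, j) bd_coef (tau j) (u a).

Definition face_chain (f : 'I_m -> {set 'I_n.+1}) (c : 'cV[int]_m) : chain n.+1 :=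
  [ffun s => \sum_j c j ord0 *+ (s == f j)].

Definition link_coord (z : chain n.+1) : 'cV[int]_m := \col_a z (u a).

Lemma boundary_face_chain f (c : 'cV[int]_m) (t : {set 'I_n.+1}) :
  boundary (face_chain f c) t = \sum_j c j ord0 * wbd (fun=> 1) (f j) t.
Proof.
rewrite boundaryE; under eq_bigr do rewrite ffunE mulr_suml.
rewrite exchange_big; apply: eq_bigr => j _ /=.
rewrite (bigD1 (f j)) //= eqxx mulr1n big1 ?addr0 // => s /negPf->.
by rewrite mulr0n mul0r.
Qed.

Lemma face_chain_supported f (c : 'cV[int]_m) (P : pred {set 'I_n.+1}) :
  (forall j, P (f j)) -> supported_on P (face_chain f c).
Proof.
move=> Pf s Ps; rewrite ffunE big1 // => j _.
by case: eqP => [sE|]; rewrite ?mulr0n //; rewrite sE Pf in Ps.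
Qed.

Lemma face_chainE f (c : 'cV[int]_m) a : injective f -> face_chain f c (f a) = c a ord0.
Proof.
move=> f_inj; rewrite ffunE (bigD1 a) //= eqxx mulr1n big1 ?addr0 // => j ja.
by rewrite (inj_eq f_inj) eq_sym (negPf ja) mulr0n.
Qed.

Lemma link_face a : (ord0 \notin u a) /\ #|u a| = k.
Proof.
have : u a \in [set u a | a : 'I_m] by apply: imset_f.
by rewrite uE inE => /andP[-> /eqP].
Qed.

Lemma link_coord_inj z1 z2 : kcycle k z1 -> kcycle k z2 ->
  link_coord z1 = link_coord z2 -> z1 = z2.
Proof.
move=> K1 K2 /colP E; apply/eqP; rewrite -subr_eq0; apply/eqP.
apply: (kcycle_eq0 (kcycleB K1 K2)) => s s0 sk.
have : s \in [set u a | a : 'I_m] by rewrite uE inE s0 sk eqxx.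
case/imsetP => a _ ->; have := E a; rewrite !mxE !ffunE => ->.
by rewrite subrr.
Qed.

Definition cone_cycle (v : 'cV[int]_m) := boundary (face_chain (fun a => ord0 |: u a) v).

Lemma cone_cycle_kcycle v : kcycle k (cone_cycle v).
Proof.
split; last exact: boundaryK.
apply/supported_boundary/face_chain_supported => a.
by have [a0 <-] := link_face a; rewrite cardsU1 a0.
Qed.

(** Removing any vertex but 0 from [ord0 |: u a] leaves a set through 0, so the only part of its
    boundary avoiding 0 is [u a], with sign 1. *)
Lemma cone_cycleK v : link_coord (cone_cycle v) = v.
Proof.
apply/colP => b; rewrite mxE boundary_face_chain.
have [b0 _] := link_face b.
rewrite (bigD1 b) //= wbd_setU1 // vsign_ord0 !mulr1 big1 ?addr0 // => a ab.
rewrite [X in _ * X](_ : _ = 0) ?mulr0 //.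
apply: contraNeq ab => /wbd_neq0[w [wb E _]]; apply/eqP/u_inj.
have [a0 _] := link_face a.
have : ord0 \in w |: u b by rewrite -E setU11.
rewrite !inE (negPf b0) orbF => /eqP w0; rewrite -w0 in E.
by rewrite -(setU1K a0) E setU1K.
Qed.

Lemma link_coord_boundary (c : 'cV[int]_m) :
  link_coord (boundary (face_chain tau c)) = link_mx *m c.
Proof.
apply/colP => a; rewrite mxE boundary_face_chain mxE.
by apply: eq_bigr => j _; rewrite mxE bd_coefE mulrC.
Qed.

Lemma tau_in j : tau j \in T.
Proof. by rewrite -tauE imset_f. Qed.

Lemma face_chain_boundary_kcycle (c : 'cV[int]_m) : kcycle k (boundary (face_chain tau c)).
Proof.
split; last exact: boundaryK.
by apply/supported_boundary/face_chain_supported => j; rewrite cardT ?tau_in.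
Qed.

Lemma supported_face_chain (c : chain n.+1) : supported_on (fun s => s \in T) c ->
  c = face_chain tau (\col_j c (tau j)).
Proof.
move=> cT; apply/ffunP => s; have [|sT] := boolP (s \in T).
  by rewrite -tauE => /imsetP[j _ ->]; rewrite face_chainE // mxE.
have fT : supported_on (fun s => s \in T) (face_chain tau (\col_j c (tau j))).
  by apply: face_chain_supported => j; apply: tau_in.
by rewrite cT // fT.
Qed.

(** Both the difference and the boundary of a chain on [T] are cycles, so by [link_coord_inj] they
    agree once their link coordinates do. *)
Lemma homologousE z1 z2 : kcycle k z1 -> kcycle k z2 ->
  homologous T z1 z2 <-> exists c, link_coord z1 - link_coord z2 = link_mx *m c.
Proof.
move=> K1 K2; have LB : link_coord z1 - link_coord z2 = link_coord (z1 - z2).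
  by apply/colP => a; rewrite !mxE !ffunE.
rewrite LB; split=> [[c [cT cE]]|[c cE]].
  exists (\col_j c (tau j)); rewrite -link_coord_boundary -supported_face_chain //.
  by apply/colP => a; rewrite !mxE -cE !ffunE.
exists (face_chain tau c); split.
  by apply: face_chain_supported => j; apply: tau_in.
have E : z1 - z2 = boundary (face_chain tau c).
  apply: link_coord_inj (kcycleB K1 K2) (face_chain_boundary_kcycle c) _.
  by rewrite cE link_coord_boundary.
by move=> t; rewrite -E !ffunE.
Qed.

Lemma hom_order_det : \det link_mx != 0 -> hom_order k T `|\det link_mx|%N.
Proof.
move=> /int_cokernel_order[vs [vs_size vs_neq vs_full]].
exists [seq cone_cycle v | v <- vs]; split.
- by rewrite size_map.
- by move=> z /mapP[v _ ->]; apply: cone_cycle_kcycle.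
- move=> i j ih jh ij; rewrite !(nth_map 0) ?vs_size //.
  move=> /homologousE H; apply: (vs_neq i j) => //.
  by have := H (cone_cycle_kcycle _) (cone_cycle_kcycle _); rewrite !cone_cycleK.
- move=> z Kz; have [w wvs E] := vs_full (link_coord z).
  exists (cone_cycle w); first exact: map_f.
  by apply/homologousE => //; [exact: cone_cycle_kcycle|rewrite cone_cycleK].
Qed.

(** A kernel vector gives a chain on [T] whose boundary has zero link coordinates; this boundary is
    a cycle, hence 0, against acyclicity. *)
Lemma det_link_neq0 :
  (forall c : chain n.+1, supported_on (fun s => s \in T) c -> boundary c = 0 -> c = 0) ->
  \det link_mx != 0.
Proof.
move=> acyc; rewrite -det_tr; apply/negP => /det0P[v v0 vA].
have Av : link_mx *m v^T = 0 by apply: trmx_inj; rewrite trmx_mul trmxK vA trmx0.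
have c0 : face_chain tau v^T = 0.
  apply: acyc; first by apply: face_chain_supported => j; apply: tau_in.
  apply: link_coord_inj (face_chain_boundary_kcycle _) _ _.
    split=> [s _|]; first by rewrite ffunE.
    by apply/ffunP => t; rewrite boundaryE ffunE big1 // => s _; rewrite ffunE mul0r.
  by rewrite link_coord_boundary Av; apply/colP => a; rewrite !mxE ffunE.
case/eqP: v0; apply/rowP => j; have := face_chainE v^T j tau_inj.
by rewrite c0 ffunE !mxE.
Qed.

End Chains.

(** * The Gram matrix of the weighted boundary *)

Lemma enum_set_inj (J : finType) (S : {set J}) m : #|S| = m ->
  exists2 u : 'I_m -> J, injective u & [set u a | a : 'I_m] = S.
Proof.
move=> <-; exists enum_val; first exact: enum_val_inj.
apply/setP => j; apply/imsetP/idP => [[a _ ->]|jS]; first exact: enum_valP.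
by exists (enum_rank_in jS j); rewrite ?enum_rankK_in.
Qed.

Lemma card_link n k :
  #|[set s : {set 'I_n.+1} | (ord0 \notin s) && (#|s| == k)]| = 'C(n, k).
Proof.
rewrite -[n in RHS](_ : #|[set~ ord0 : 'I_n.+1]| = n); last by rewrite cardsC1 card_ord.
by rewrite -cards_draws; apply: eq_card => s; rewrite !inE subsetC sub1set inE.
Qed.

(** Pascal's rule, after counting the sets that avoid both vertex 0 and [v]. *)
Lemma card_link_vertex n k (v : 'I_n.+2) : v != ord0 ->
  #|[set s in [set s : {set 'I_n.+2} | (ord0 \notin s) && (#|s| == k.+1)] | v \in s]| = 'C(n, k).
Proof.
move=> v0; set U := [set s : {set 'I_n.+2} | (ord0 \notin s) && (#|s| == k.+1)].
have := cardsID [set s : {set 'I_n.+2} | v \in s] U.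
rewrite card_link binS addnC.
have -> : #|U :\: [set s : {set 'I_n.+2} | v \in s]| = 'C(n, k.+1).
  have cn : #|~: [set ord0; v]| = n.
    by rewrite cardsCs setCK cards2 eq_sym v0 card_ord subn2.
  rewrite -[in RHS]cn -cards_draws; apply: eq_card => s.
  by rewrite !inE subsetC subUset !sub1set !inE; case: (v \in s); rewrite ?andbF ?andbT.
move=> /addnI <-; apply: eq_card => s; rewrite !inE.
by case: (v \in s); rewrite ?andbF ?andbT.
Qed.

Lemma prod_face_weights (R : comNzRingType) n (S : {set {set 'I_n}}) (y : 'I_n -> R) :
  \prod_(s in S) \prod_(i in s) y i = \prod_i y i ^+ #|[set s in S | i \in s]|.
Proof.
rewrite (exchange_big_dep predT) //=; apply: eq_bigr => i _.
by rewrite -prodr_const; apply: eq_bigl => s; rewrite inE.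
Qed.

Section Gram.
Variables (n k m : nat) (R : realFieldType) (x : 'I_n.+2 -> R).
Variables (u tau : 'I_m -> {set 'I_n.+2}).
Hypothesis u_inj : injective u.
Hypothesis uE :
  [set u a | a : 'I_m] = [set s : {set 'I_n.+2} | (ord0 \notin s) && (#|s| == k.+1)].
Hypothesis card_tau : forall j, #|tau j| = k.+2.
Hypothesis x0 : forall i, x i != 0.

Definition wlink_mx : 'M[R]_m := \matrix_(a, j) wbd x (tau j) (u a).

(** Weight 0 at vertex 0 restricts the boundary to the simplex on the other vertices without
    changing the vertex type. *)
Definition x' i := if i == ord0 then 0 else x i.

Definition link_lap : 'M[R]_m := \matrix_(a, b) wlap x' (u a) (u b).

Lemma sum_x' : \sum_i x' i ^+ 2 = \sum_i x i ^+ 2 - x ord0 ^+ 2.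
Proof.
rewrite big_ord_recl [in RHS]big_ord_recl /x' eqxx expr0n add0r.
by rewrite addrAC subrr add0r; apply: eq_bigr.
Qed.

Lemma u_link a : ord0 \notin u a /\ #|u a| = k.+1.
Proof. exact: (link_face uE). Qed.

Lemma sum_link (V : nmodType) (F : {set 'I_n.+2} -> V) :
  (forall s, F s != 0 -> (ord0 \notin s) && (#|s| == k.+1)) -> \sum_s F s = \sum_a F (u a).
Proof.
move=> F0; rewrite (bigID (mem [set u a | a : 'I_m])) /= addrC big1 ?add0r.
  by rewrite big_imset //=; apply: in2W.
move=> s; rewrite uE inE => sU; apply: contraNeq sU; exact: F0.
Qed.

Lemma wbd_x'_link (s t : {set 'I_n.+2}) : ord0 \notin t -> wbd x' s t != 0 -> ord0 \notin s.
Proof.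
move=> t0 /wbd_neq0[v [_ -> v0]]; rewrite !inE (negPf t0) orbF.
by apply: contraNneq v0 => <-; rewrite /x' eqxx.
Qed.

Lemma wbd_x'_face (s t : {set 'I_n.+2}) : ord0 \notin s -> wbd x' s t != 0 -> ord0 \notin t.
Proof. by move=> s0 /wbd_neq0[v [_ sE _]]; apply: contraNN s0; rewrite sE !inE orbC => ->. Qed.

(** [wlap x'] links a set [u a] only to sets of the same kind, so the sum over all sets in
    [wlap_sqr] reduces to the index type of [u]. *)
Lemma link_lap_sqr : link_lap *m link_lap = (\sum_i x' i ^+ 2) *: link_lap.
Proof.
apply/matrixP => a c; rewrite !mxE -wlap_sqr sum_link => [|s].
  by apply: eq_bigr => b _; rewrite !mxE.
rewrite mulf_eq0 negb_or => /andP[+ _]; apply: contraNT => sU.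
rewrite /wlap big1 // => t _; apply/eqP; apply: contraNT sU.
rewrite mulf_eq0 negb_or => /andP[h1 h2]; have [a0 ak] := u_link a.
have t0 := wbd_x'_face a0 h1; rewrite (wbd_x'_link t0 h2).
by rewrite (wbd_card h2) -(wbd_card h1) ak /=.
Qed.

(** The diagonal entry at [a] is the sum of x'_v^2 over [u a], and each vertex other than 0 lies in
    ['C(n, k)] of these sets. *)
Lemma link_lap_trace : \tr link_lap = 'C(n, k)%:R * \sum_i x' i ^+ 2.
Proof.
rewrite /mxtrace; under eq_bigr do rewrite mxE /wlap wbd_norm.
rewrite -(big_imset (fun s : {set 'I_n.+2} => \sum_(v in s) x' v ^+ 2) (in2W u_inj)) /=.
rewrite uE (exchange_big_dep predT) //= mulr_sumr; apply: eq_bigr => v _.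
rewrite sumr_const; have [->|v0] := eqVneq v ord0.
  by rewrite /x' eqxx expr0n mulr0 mul0rn.
rewrite -(card_link_vertex k v0) mulr_natl; congr (_ *+ _).
apply: eq_card => s.
by rewrite [LHS]unfold_in !inE.
Qed.

Lemma sum_x'_gt0 : 0 < \sum_i x' i ^+ 2.
Proof.
rewrite (bigD1 (lift ord0 ord0)) //= ltr_wpDr ?sumr_ge0 // => [i _|].
  exact: sqr_ge0.
by rewrite exprn_even_gt0 //=; exact: x0.
Qed.

Lemma det_link_lap :
  \det (1%:M + (x ord0 ^- 2) *: link_lap) =
  ((\sum_i x i ^+ 2) / x ord0 ^+ 2) ^+ 'C(n, k).
Proof.
set s' := \sum_i x' i ^+ 2.
have s'0 : s' != 0 by rewrite gt_eqF // sum_x'_gt0.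
have x00 : x ord0 ^+ 2 != 0 by rewrite expf_eq0 /= x0.
(* Dividing by [s'] makes [link_lap] idempotent with trace ['C(n, k)]. *)
have -> : x ord0 ^- 2 *: link_lap = (s' / x ord0 ^+ 2) *: (s'^-1 *: link_lap).
  by rewrite scalerA mulrAC mulfV // mul1r.
rewrite (@det_1add_idempotent _ _ 'C(n, k)).
- by congr (_ ^+ _); rewrite /s' sum_x' mulrBl mulfV // addrC subrK.
- rewrite -scalemxAl -scalemxAr link_lap_sqr !scalerA -/s'.
  by congr (_ *: _); rewrite divfK.
- by rewrite mxtraceZ link_lap_trace -/s' mulrC mulfK.
Qed.

Lemma gram_wlink i j :
  \sum_s wbd x (tau i) s * wbd x (tau j) s =
  (wlink_mx^T *m (1%:M + (x ord0 ^- 2) *: link_lap) *m wlink_mx) i j.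
Proof.
have cardF s : wbd x (tau i) s * wbd x (tau j) s != 0 -> #|s| = k.+1.
  by rewrite mulf_eq0 negb_or => /andP[/wbd_card + _]; rewrite card_tau => -[].
(* The boundary of [tau j'] is itself a cycle, so [wbd_cycle_ord0] applies; on sets avoiding vertex
   0 the weights [x] and [x'] agree. *)
have cone j' (t : {set 'I_n.+2}) : ord0 \notin t ->
    wbd x (tau j') (ord0 |: t) = - (x ord0)^-1 * \sum_a wbd x (tau j') (u a) * wbd x' (u a) t.
  move=> t0; have := wbd_cycle_ord0 t0 (wbd_sqr x (tau j') t).
  move=> /(canRL (mulfK (x0 ord0)))->; rewrite mulrC mulNr mulrN; congr (- (_ * _)).
  rewrite big_mkcond /= sum_link => [|s].
    apply: eq_bigr => a _; have [a0 _] := u_link a; rewrite a0; congr (_ * _).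
    by apply: eq_wbd => v va; rewrite /x'; case: eqP => // v0; rewrite v0 (negPf a0) in va.
  case: ifP => _; last (by rewrite eqxx); rewrite mulf_eq0 negb_or => /andP[/wbd_card + _].
  by rewrite card_tau => -[->] /=.
(* Sets avoiding vertex 0 account for the identity matrix, those through it for the multiple of
   [link_lap]. *)
rewrite (bigID (fun s : {set 'I_n.+2} => ord0 \in s)) /= big_setU1_ord0 addrC.
rewrite mulmxDr mulmx1 mulmxDl mxE; congr (_ + _).
  rewrite big_mkcond /= sum_link => [|s].
    by rewrite mxE; apply: eq_bigr => a _; have [-> _] := u_link a; rewrite !mxE.
  by case: ifP => _; [move=> /cardF ->; rewrite eqxx | rewrite eqxx].
rewrite -scalemxAr -scalemxAl mxE.
transitivity (x ord0 ^- 2 * \sum_t (\sum_a wbd x (tau i) (u a) * wbd x' (u a) t) *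
                         (\sum_a wbd x (tau j) (u a) * wbd x' (u a) t)).
  rewrite mulr_sumr [RHS](bigID (fun s : {set 'I_n.+2} => ord0 \in s)) /= [X in X + _]big1.
    rewrite add0r; apply: eq_bigr => t t0; rewrite !cone //.
    by rewrite mulrACA mulrNN -invfM -expr2.
  move=> t t0; rewrite big1 ?mul0r ?mulr0 // => a _.
  rewrite [X in _ * X](_ : _ = 0) ?mulr0 //; apply: contraTeq t0.
  by apply: wbd_x'_face; have [] := u_link a.
congr (_ * _).
transitivity (\sum_a \sum_b wlink_mx a i * link_lap a b * wlink_mx b j); last first.
  rewrite mxE exchange_big; apply: eq_bigr => b _.
  by rewrite [(_ *m link_lap) _ _]mxE mulr_suml; apply: eq_bigr => a _; rewrite [wlink_mx^T _ _]mxE.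
have BE a j' : wbd x (tau j') (u a) = wlink_mx a j' by rewrite mxE.
under eq_bigr do rewrite mulr_suml.
rewrite exchange_big; apply: eq_bigr => a _ /=.
under [RHS]eq_bigr do rewrite [link_lap _ _]mxE /wlap mulr_sumr mulr_suml.
rewrite [RHS]exchange_big; apply: eq_bigr => t _; rewrite mulr_sumr.
by apply: eq_bigr => b _; rewrite !BE; ring.
Qed.

Lemma det_wlink_le :
  \det wlink_mx ^+ 2 * ((\sum_i x i ^+ 2) / x ord0 ^+ 2) ^+ 'C(n, k) <=
  \prod_j \sum_(i in tau j) x i ^+ 2.
Proof.
(* The columns run over all sets; those that are not facets of a face contribute only zeros to the
   Gram matrix. *)
pose A : 'M[R]_(m, #|{set 'I_n.+2}|) := \matrix_(j, s) wbd x (tau j) (enum_val s).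
have AE i j : (A *m A^T) i j = \sum_s wbd x (tau i) s * wbd x (tau j) s.
  rewrite mxE [RHS](reindex (@enum_val _ predT)) /=; last exact: onW_bij (enum_val_bij _).
  by apply: eq_bigr => s _; rewrite !mxE.
have AG : A *m A^T = wlink_mx^T *m (1%:M + (x ord0 ^- 2) *: link_lap) *m wlink_mx.
  by apply/matrixP => i j; rewrite AE gram_wlink.
have /andP[_] := hadamard_gram A.
rewrite (eq_bigr (fun j => \sum_(i in tau j) x i ^+ 2)) => [|j _]; last by rewrite AE wbd_norm.
by rewrite AG !det_mulmx det_tr det_link_lap mulrAC -expr2.
Qed.

Lemma det_wlink :
  \det wlink_mx * \prod_a \prod_(v in u a) x v =
  (\det (link_mx u tau))%:~R * \prod_j \prod_(v in tau j) x v.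
Proof.
pose du : 'rV[R]_m := \row_a \prod_(v in u a) x v.
pose dt : 'rV[R]_m := \row_j \prod_(v in tau j) x v.
have E : diag_mx du *m wlink_mx = map_mx intr (link_mx u tau) *m diag_mx dt.
  rewrite mul_diag_mx mul_mx_diag; apply/matrixP => a j; rewrite !mxE mulrC wbd_scale.
  congr (_ * _); rewrite bd_coefE rmorph_sum /=; apply: eq_bigr => v _.
  by rewrite !mul1r !vsignE rmorphXn rmorphN1.
have := congr1 determinant E; rewrite !det_mulmx !det_diag det_map_mx mulrC.
by under eq_bigr do rewrite mxE; under [in RHS]eq_bigr do rewrite mxE.
Qed.

End Gram.

(** * From determinants to the bound in terms of degrees *)

Theorem theorem2 (R : realType) (n k : nat) (T : {set {set 'I_n}}) :
  (1 <= k)%N -> (k < n)%N -> Qacyclic k T ->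
  exists h : nat, hom_order k T h /\
    forall x : 'I_n -> R, (forall i, x i != 0) ->
      ((h ^ 2)%N%:R : R) <=
        (\prod_(i : 'I_n) (x i ^+ 2) ^ ('C(n - 2, k - 1)%:Z - (degree T i)%:Z))
        / (\sum_(i : 'I_n) x i ^+ 2) ^+ 'C(n - 2, k - 1)
        * \prod_(tau in T) \sum_(i in tau) x i ^+ 2.
Proof.
case: k => // k; case: n T => [|[|n]] // T _ _ [cardT sizeT acyc].
rewrite !subSS !subn0.
(* [T] has as many faces as there are [k.+1]-subsets avoiding vertex 0, so both families share an
   index type and the matrices are square. *)
have [u u_inj uE] := enum_set_inj (card_link n.+1 k.+1).
have [tau tau_inj tauE] := enum_set_inj sizeT.
have tau_card j : #|tau j| = k.+2 by apply: cardT; rewrite -tauE imset_f.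
exists `|\det (link_mx u tau)|%N; split.
  by apply: hom_order_det => //; apply: (det_link_neq0 tau_inj uE tauE cardT acyc).
move=> x x0; set h := \det _; set m1 := 'C(n, k).
have y0 i : x i ^+ 2 != 0 by rewrite expf_eq0 /= x0.
have s0 : 0 < \sum_i x i ^+ 2.
  rewrite (bigD1 ord0) //= ltr_wpDr ?sumr_ge0 // => [i _|]; first exact: sqr_ge0.
  by rewrite exprn_even_gt0 //= x0.
have := det_wlink_le u_inj uE tau_card x0; rewrite -/m1.
have := det_wlink x u tau; rewrite -/h.
set D := \det _; set PU := \prod_a _; set PT := \prod_j _; set s := \sum_i _.
have -> : \prod_j \sum_(i in tau j) x i ^+ 2 = \prod_(t in T) \sum_(i in t) x i ^+ 2.
  by rewrite -tauE big_imset //; apply: in2W.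
set P := \prod_(t in T) _; set W := \prod_i _ => DPU DP.
(* Every vertex but 0 lies in [m1] of the sets [u a], and 0 in none; the extra power of x_0
   completes the monomial. *)
have PUE : x ord0 ^+ m1 * PU = \prod_i x i ^+ m1.
  rewrite [RHS](bigD1 ord0) //=; congr (_ * _).
  rewrite /PU -(big_imset (fun t : {set 'I_n.+2} => \prod_(v in t) x v) (in2W u_inj)) /= uE.
  rewrite prod_face_weights (bigD1 ord0) //= [X in _ ^+ X](_ : _ = 0%N) ?mul1r.
    by apply: eq_bigr => i i0; rewrite card_link_vertex.
  by apply: eq_card0 => t; rewrite !inE; case: (ord0 \in t); rewrite ?andbF.
have PTE : PT = \prod_i x i ^+ degree T i.
  rewrite /PT -(big_imset (fun t : {set 'I_n.+2} => \prod_(v in t) x v) (in2W tau_inj)) /= tauE.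
  exact: prod_face_weights.
(* The square of [PT] supplies the powers x_i^(2 d_i) that clear the possibly negative exponents in
   [W]. *)
have WE : W * PT ^+ 2 = (x ord0 ^+ m1 * PU) ^+ 2.
  rewrite PUE PTE -!prodrXl -big_split; apply: eq_bigr => i _ /=.
  by rewrite -!exprM !(mulnC _ 2) !exprM [_ ^+ degree T i]exprnP -expfzDr // subrK.
have PT0 : PT != 0 by rewrite PTE; apply/prodf_neq0 => i _; rewrite expf_neq0.
(* Since h = D PU / PT, its square is the left side of [DP] times the nonnegative factor W /
   s^m1. *)
have hE : (`|h| ^ 2)%N%:R = W / s ^+ m1 * (D ^+ 2 * (s / x ord0 ^+ 2) ^+ m1).
  rewrite natrX natr_absz intr_norm real_normK ?num_real //.
  have -> : h%:~R = D * PU / PT by rewrite DPU mulfK.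
  have -> : W = (x ord0 ^+ m1 * PU) ^+ 2 / PT ^+ 2 by rewrite -WE mulfK ?expf_neq0.
  rewrite (expr_div_n s) exprAC.
  have sm : s ^+ m1 != 0 by rewrite expf_neq0 ?gt_eqF.
  have xm : x ord0 ^+ m1 != 0 by rewrite expf_neq0.
  by move: (s ^+ m1) (x ord0 ^+ m1) sm xm => sm xm sm0 xm0; field; rewrite PT0 sm0 xm0.
rewrite hE ler_wpM2l // divr_ge0 ?exprn_ge0 ?(ltW s0) //.
by rewrite /W prodr_ge0 // => i _; rewrite exprz_ge0 ?sqr_ge0.
Qed.
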